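(* There is an absolute constant $c>0$ such that for every compact connected subset $K$ of $\mathbb{D}$ and every $0<\varepsilon<1$: if $\operatorname{diam}_\rho K>1-\varepsilon$, then $\operatorname{Cap}(K)\ge c\log(1/\varepsilon)$. In particular, $\operatorname{Cap}(K)\to\infty$ as $\operatorname{diam}_\rho K\to1$.
   Context: Pseudo-hyperbolic distance: $\rho(z,w)=\left|\frac{z-w}{1-\bar zw}\right|$ for $z,w\in\mathbb{D}$; $\operatorname{diam}_\rho$ is the diameter for this metric. Green capacity: $g(z,w)=\log\left|\frac{1-\bar wz}{z-w}\right|$, $I(\mu)=\iint g\,d\mu\,d\mu$, $V(K)=\inf I(\mu)$ over probability measures supported by $K$, $\operatorname{Cap}(K)=1/V(K)$. *)

(* Defs.v *)
(* The complex plane is modelled as R * R,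
   the pair (x, y) standing for x + i y, with the product topology and
   the product (= Borel) sigma-algebra. *)
From HB Require Import structures.
From mathcomp Require Import all_boot all_order all_algebra.
From mathcomp Require Import all_classical all_reals all_analysis.
Set Implicit Arguments. Unset Strict Implicit. Unset Printing Implicit Defensive.
Import Order.TTheory GRing.Theory Num.Theory.
Import numFieldNormedType.Exports.
Local Open Scope classical_set_scope.
Local Open Scope ring_scope.

Section Defs.
Variable R : realType.
Local Notation C := (R * R)%type.

Definition csqnorm (z : C) : R := z.1 ^+ 2 + z.2 ^+ 2.

Definition disc : set C := [set z | csqnorm z < 1].

(* pseudo-hyperbolic distance rho(z,w) = |z - w| / |1 - conj(z) w|.
   conj(z) w = (z1 w1 + z2 w2) + i (z1 w2 - z2 w1). *)
Definition rho (z w : C) : R :=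
  Num.sqrt (csqnorm (z.1 - w.1, z.2 - w.2)) /
  Num.sqrt (csqnorm (1 - (z.1 * w.1 + z.2 * w.2), - (z.1 * w.2 - z.2 * w.1))).

Definition diam_rho (K : set C) : R :=
  sup [set rho z w | z in K & w in K].

(* Green function g(z,w) = log |(1 - conj(w) z)/(z - w)| = - log rho(z,w),
   valued in the extended reals, equal to +oo on the diagonal. *)
Definition green (z w : C) : \bar R :=
  if z == w then +oo%E else (- ln (rho z w))%:E.

Definition energy (mu : probability C R) : \bar R :=
  (\int[mu]_z \int[mu]_w green z w)%E.

Definition green_V (K : set C) : \bar R :=
  ereal_inf [set energy mu | mu in [set mu : probability C R | mu (~` K) = 0%E]].

Definition green_cap (K : set C) : \bar R :=
  match green_V K with
  | +oo%E => 0%E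
  | -oo%E => +oo%E
  | EFin v => if v == 0 then +oo%E else (v^-1)%:E
  end.

End Defs.

(* Main.v *)
Require Import Defs.
From HB Require Import structures.
From mathcomp Require Import all_boot all_order all_algebra.
From mathcomp Require Import all_classical all_reals all_analysis.
From mathcomp Require Import measurable_realfun ring lra.
Import Order.TTheory GRing.Theory Num.Theory.
Import numFieldNormedType.Exports.
Local Open Scope classical_set_scope.
Local Open Scope ring_scope.

(* Choose a, b in K with rho(a,b) > 1 - eps and let T be the hyperbolic distance
   to a, T(z) = log((1 + rho(a,z))/(1 - rho(a,z))), so that
   L := T(b) >= log(1/eps). As K is connected, T(K) contains [0,L]; a measurable
   section of T over [0,L] carries the uniform probability of [0,L] to a
   probability measure on K. The triangle inequality |T(z) - T(w)| <= T_z(w)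
   gives, with q = exp(-|T(z) - T(w)|),
     g(z,w) <= log((1 + q)/(1 - q)) <= 3 q / sqrt(1 - q),
   whose integral over each half-line is 6. Hence the potential of the measure is
   at most 12/L on its support, V(K) <= 12/L, and the constant c = 1/12 works. *)

(** * Pseudo-hyperbolic and hyperbolic geometry of the disc *)

Section pseudohyperbolic.
Context {R : realType}.
Implicit Types a z w : (R * R)%type.

Definition cdist2 z w : R := csqnorm (z.1 - w.1, z.2 - w.2).

Definition ccross2 z w : R :=
  csqnorm (1 - (z.1 * w.1 + z.2 * w.2), - (z.1 * w.2 - z.2 * w.1)).

Lemma rhoE z w : rho z w = Num.sqrt (cdist2 z w) / Num.sqrt (ccross2 z w).
Proof. by []. Qed.

Lemma csqnorm_ge0 z : 0 <= csqnorm z.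
Proof. by rewrite addr_ge0 ?sqr_ge0. Qed.

Lemma cdist2_eq0 z w : (cdist2 z w == 0) = (z == w).
Proof.
by rewrite /cdist2 /csqnorm/= paddr_eq0 ?sqr_ge0// !sqrf_eq0 !subr_eq0.
Qed.

(** This identity is why [rho] behaves well on the disc: it makes the denominator positive, and it
    turns [1 - rho ^+ 2] into an explicit quotient. *)
Lemma ccross2E z w :
  ccross2 z w = cdist2 z w + (1 - csqnorm z) * (1 - csqnorm w).
Proof. by rewrite /ccross2 /cdist2 /csqnorm /=; ring. Qed.

Lemma ccross2_gt0 z w : disc z -> disc w -> 0 < ccross2 z w.
Proof.
move=> dz dw; rewrite ccross2E ltr_wpDl ?csqnorm_ge0//.
by rewrite mulr_gt0// subr_gt0.
Qed.

Lemma sqr_rho z w : disc z -> disc w ->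
  rho z w ^+ 2 = 1 - (1 - csqnorm z) * (1 - csqnorm w) / ccross2 z w.
Proof.
move=> dz dw; have D0 := ccross2_gt0 _ _ dz dw.
rewrite rhoE exprMn exprVn !sqr_sqrtr ?csqnorm_ge0//.
by rewrite ccross2E in D0 *; field; rewrite gt_eqF.
Qed.

Lemma rho_ge0 z w : 0 <= rho z w.
Proof. by rewrite divr_ge0 ?sqrtr_ge0. Qed.

Lemma rho_lt1 z w : disc z -> disc w -> rho z w < 1.
Proof.
move=> dz dw; have D0 := ccross2_gt0 _ _ dz dw.
rewrite -(@ltr_pXn2r _ 2)// ?nnegrE ?rho_ge0// expr1n sqr_rho//.
by rewrite gtrBl divr_gt0// mulr_gt0// subr_gt0.
Qed.

Lemma rho_gt0 z w : disc z -> disc w -> z != w -> 0 < rho z w.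
Proof.
move=> dz dw zw; have D0 := ccross2_gt0 _ _ dz dw.
rewrite rhoE divr_gt0// sqrtr_gt0// lt_neqAle csqnorm_ge0 andbT eq_sym.
by rewrite cdist2_eq0.
Qed.

Lemma rhozz z : rho z z = 0.
Proof.
rewrite rhoE (_ : cdist2 z z = 0) ?sqrtr0 ?mul0r//.
by apply/eqP; rewrite cdist2_eq0.
Qed.

(** Reverse triangle inequality for the modulus, squared. It reduces to Cauchy-Schwarz, which
    follows from the nonnegative square of the determinant. *)
Lemma csqnormB_ge (u v : R * R) :
  (Num.sqrt (csqnorm u) - Num.sqrt (csqnorm v)) ^+ 2 <=
  csqnorm (u.1 - v.1, u.2 - v.2).
Proof.
rewrite sqrrB !sqr_sqrtr ?csqnorm_ge0// -sqrtrM ?csqnorm_ge0//.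
have : u.1 * v.1 + u.2 * v.2 <= Num.sqrt (csqnorm u * csqnorm v).
  apply: (le_trans (ler_norm _)); rewrite -sqrtr_sqr ler_wsqrtr//.
  have := sqr_ge0 (u.1 * v.2 - u.2 * v.1); rewrite /csqnorm; nra.
by rewrite /csqnorm/=; nra.
Qed.

(* With z' and w' the images of z and w under the Moebius map sending a to 0,
   this says |1 - conj(z') w'| >= 1 - |z'||w'|, cleared of denominators. *)
Lemma moebius_cross_ge a z w :
  (Num.sqrt (ccross2 a z) * Num.sqrt (ccross2 a w) -
   Num.sqrt (cdist2 a z) * Num.sqrt (cdist2 a w)) ^+ 2 <=
  (1 - csqnorm a) ^+ 2 * ccross2 z w.
Proof.
pose m (u v : R * R) := (u.1 * v.1 - u.2 * v.2, u.1 * v.2 + u.2 * v.1).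
have mE u v : csqnorm (m u v) = csqnorm u * csqnorm v.
  by rewrite /csqnorm/=; ring.
(* In complex notation A = (1 - a conj(z))(1 - conj(a) w) and B = conj(a - z)(a - w), so that A - B
   = (1 - |a|^2)(1 - conj(z) w). *)
pose A := m (1 - (a.1 * z.1 + a.2 * z.2), a.1 * z.2 - a.2 * z.1)
            (1 - (a.1 * w.1 + a.2 * w.2), - (a.1 * w.2 - a.2 * w.1)).
pose B := m (a.1 - z.1, - (a.2 - z.2)) (a.1 - w.1, a.2 - w.2).
have := csqnormB_ge A B.
have -> : csqnorm A = ccross2 a z * ccross2 a w.
  by rewrite mE; congr (_ * _); rewrite /ccross2 /csqnorm/=; ring.
have -> : csqnorm B = cdist2 a z * cdist2 a w.
  by rewrite mE; congr (_ * _); rewrite /cdist2 /csqnorm/=; ring.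
rewrite !sqrtrM ?csqnorm_ge0// => /le_trans; apply.
rewrite le_eqVlt; apply/orP; left; apply/eqP.
by rewrite /ccross2 /csqnorm/=; ring.
Qed.

(** Triangle inequality of the hyperbolic metric in tanh form, obtained from the Moebius estimate by
    passing to squares. *)
Lemma rho_strong_triangle a z w : disc a -> disc z -> disc w ->
  `|rho a z - rho a w| <= rho z w * (1 - rho a z * rho a w).
Proof.
move=> da dz dw; set p := rho a z; set r := rho a w.
have p0 : 0 <= p by exact: rho_ge0.
have r0 : 0 <= r by exact: rho_ge0.
have p1 : p < 1 by exact: rho_lt1.
have r1 : r < 1 by exact: rho_lt1.
have pr1 : 0 < 1 - p * r by nra.
rewrite -(@ler_pXn2r _ 2)// ?nnegrE ?normr_ge0//; last first.
  by rewrite mulr_ge0 ?rho_ge0// ltW.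
rewrite real_normK ?num_real// exprMn sqr_rho//.
have Az := ccross2_gt0 _ _ da dz; have Aw := ccross2_gt0 _ _ da dw.
have Dzw := ccross2_gt0 _ _ dz dw.
have Ez : (1 - p ^+ 2) * ccross2 a z = (1 - csqnorm a) * (1 - csqnorm z).
  by rewrite sqr_rho//; field; rewrite gt_eqF.
have Ew : (1 - r ^+ 2) * ccross2 a w = (1 - csqnorm a) * (1 - csqnorm w).
  by rewrite sqr_rho//; field; rewrite gt_eqF.
have := moebius_cross_ge a z w.
have sz : 0 < Num.sqrt (ccross2 a z) by rewrite sqrtr_gt0.
have sw : 0 < Num.sqrt (ccross2 a w) by rewrite sqrtr_gt0.
have -> : Num.sqrt (cdist2 a z) = p * Num.sqrt (ccross2 a z).
  by rewrite /p rhoE divfK ?gt_eqF.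
have -> : Num.sqrt (cdist2 a w) = r * Num.sqrt (ccross2 a w).
  by rewrite /r rhoE divfK ?gt_eqF.
rewrite [X in X ^+ 2](_ : _ = (1 - p * r) *
  (Num.sqrt (ccross2 a z) * Num.sqrt (ccross2 a w))); last by ring.
rewrite !exprMn !sqr_sqrtr ?csqnorm_ge0// => H.
have a0 : 0 < 1 - csqnorm a by rewrite subr_gt0.
(* Uses (1 - pr)^2 - (p - r)^2 = (1 - p^2)(1 - r^2). *)
suff : (1 - p * r) ^+ 2 * ((1 - csqnorm z) * (1 - csqnorm w) / ccross2 z w)
    <= (1 - p ^+ 2) * (1 - r ^+ 2) by nra.
(* The factor (1 - |a|^2)^2 lets [Ez] and [Ew] bring out (1 - p^2)(1 - r^2) on both sides; what
   remains is [H]. *)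
rewrite mulrA ler_pdivrMr// -(@ler_pM2l _ ((1 - csqnorm a) ^+ 2)) ?exprn_gt0//.
rewrite (_ : _ * (_ * (_ * _)) = (1 - p * r) ^+ 2 *
  ((1 - csqnorm a) * (1 - csqnorm z)) * ((1 - csqnorm a) * (1 - csqnorm w)));
  last by ring.
rewrite -Ez -Ew.
rewrite (_ : (1 - p * r) ^+ 2 * _ * _ = (1 - p ^+ 2) * (1 - r ^+ 2) *
  ((1 - p * r) ^+ 2 * (ccross2 a z * ccross2 a w))); last by ring.
rewrite [leRHS]mulrCA ler_wpM2l// mulr_ge0 ?subr_ge0// expr_le1// ltW//.
Qed.

(** This is 2 artanh(rho), normalised so that its exponential is rational in [rho]. *)
Definition hypdist a z : R := ln ((1 + rho a z) / (1 - rho a z)).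

Lemma expR_hypdist a z : disc a -> disc z ->
  expR (hypdist a z) = (1 + rho a z) / (1 - rho a z).
Proof.
move=> da dz; rewrite lnK// posrE divr_gt0 ?subr_gt0 ?rho_lt1//.
by rewrite ltr_wpDr ?rho_ge0.
Qed.

(** The strong triangle inequality gives rho(z,w) >= (1 - q)/(1 + q), and elementary bounds on the
    logarithm do the rest. The kernel q / sqrt(1 - q) is chosen because its singularity at q = 1 is
    integrable and its antiderivative is explicit. *)
Lemma green_le_hypdist a z w : disc a -> disc z -> disc w ->
  hypdist a z != hypdist a w ->
  let q := expR (- `|hypdist a z - hypdist a w|) in
  (green z w <= (3 * (q / Num.sqrt (1 - q)))%:E)%E.
Proof.
move=> da dz dw; wlog : z w dz dw / hypdist a w < hypdist a z.
  move=> wlg; rewrite neq_lt => /orP[h|h].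
    have := wlg w z dw dz h; rewrite gt_eqF// distrC => /(_ isT).
    have rhoC : rho w z = rho z w.
      by rewrite !rhoE; congr (Num.sqrt _ / Num.sqrt _);
         rewrite /cdist2 /ccross2 /csqnorm/=; ring.
    by rewrite /green rhoC eq_sym.
  by have := wlg z w dz dw h; rewrite gt_eqF// => /(_ isT).
move=> wz _; rewrite /= gtr0_norm ?subr_gt0// opprB.
set q := expR _.
have q0 : 0 < q by exact: expR_gt0.
have q1 : q < 1 by rewrite -[ltRHS]expR0 ltr_expR subr_lt0.
have zw : z != w by apply: contraTneq wz => ->; rewrite ltxx.
rewrite /green (negbTE zw) lee_fin.
set p := rho a z; set r := rho a w.
have p0 : 0 <= p by exact: rho_ge0.
have r0 : 0 <= r by exact: rho_ge0.
have p1 : p < 1 by exact: rho_lt1.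
have r1 : r < 1 by exact: rho_lt1.
have pr1 : 0 < 1 - p * r by nra.
(* Equivalently (1 - q)/(1 + q) = (p - r)/(1 - pr), the quantity controlled by the strong triangle
   inequality. *)
have qE : q * ((1 - r) * (1 + p)) = (1 + r) * (1 - p).
  rewrite /q expRD expRN !expR_hypdist// -/p -/r; field.
  by rewrite !gt_eqF ?subr_gt0// ltr_wpDr.
have xy : (1 - q) / (1 + q) <= rho z w.
  have := rho_strong_triangle a _ _ da dz dw.
  rewrite -/p -/r => /(le_trans (ler_norm _)).
  rewrite -ler_pdivrMr//; apply: le_trans.
  rewrite ler_pdivrMr ?addr_gt0// mulrAC ler_pdivlMr//.
  suff : (1 - q) * (1 - p * r) = (p - r) * (1 + q) by move=> ->.
  by move: qE; lra.
have x0 : 0 < rho z w by exact: rho_gt0.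
have y0 : 0 < (1 - q) / (1 + q) by rewrite divr_gt0 ?subr_gt0 ?addr_gt0.
have : - ln (rho z w) <= - ln ((1 - q) / (1 + q)) by rewrite lerN2 ler_ln.
move=> /le_trans; apply.
rewrite ln_div ?posrE ?subr_gt0 ?addr_gt0// opprB.
have l1 : ln (1 + q) <= q by rewrite le_ln1Dx//; lra.
set s := Num.sqrt _.
have s0 : 0 < s by rewrite sqrtr_gt0 subr_gt0.
have sE : s ^+ 2 = 1 - q by rewrite sqr_sqrtr// subr_ge0 ltW.
have s1 : s <= 1 by nra.
(* The bound ln(1 + x) <= x is applied to 1/s rather than to 1/s^2 = 1/(1 - q), which would only
   give the non-integrable q/(1 - q). *)
have l2 : - ln (1 - q) <= 2 * (s^-1 - 1).
  rewrite -sE lnXn// -mulNrn -lnV ?posrE//.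
  have := @le_ln1Dx R (s^-1 - 1).
  rewrite addrCA subrr addr0 ltrBDl subrr invr_gt0 => /(_ s0).
  by rewrite mulr2n; lra.
have l3 : s^-1 - 1 <= q / s.
  by rewrite ler_pdivlMr// mulrBl mulVf ?gt_eqF//; nra.
have l4 : q <= q / s by rewrite ler_pdivlMr//; nra.
lra.
Qed.

End pseudohyperbolic.

(** * Integrals of the singular kernel *)

Section improper_integral.
Context {R : realType}.
Local Notation mu := (@lebesgue_measure R).

Lemma itv_oo_bigcup (a b : R) :
  `]a, b[%classic =
  \bigcup_n `[a + n.+1%:R^-1, b - n.+1%:R^-1]%classic :> set R.
Proof.
apply/seteqP; split=> [x /=|x [n _ /=]]; rewrite !in_itv/=; last first.
  have h : 0 < n.+1%:R^-1 :> R by rewrite invr_gt0 ltr0n.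
  by move: (n.+1%:R^-1) h => e h /andP[ax xb]; apply/andP; split; lra.
move=> /andP[ax xb].
have e0 : 0 < Num.min (x - a) (b - x) by rewrite lt_min !subr_gt0 ax xb.
have [n] := ltr_add_invr e0.
rewrite add0r lt_min => /andP[na nb].
exists n => //=; rewrite in_itv/=; move: (n.+1%:R^-1) na nb => e na nb.
by apply/andP; split; lra.
Qed.

(** The integrand may blow up at the end points, so the fundamental theorem is applied on the
    compact intervals exhausting []a, b[], followed by monotone convergence. The bound [M] on the
    increments of [F] stands in for its boundary values. *)
Lemma integral_le_antiderivative (a b M : R) (F f : R -> R)
    (g : R -> \bar R) :
  0 <= M ->
  {in `]a, b[, forall x : R, is_derive x 1 F (f x)} ->
  {in `]a, b[, continuous f} ->
  measurable_fun `]a, b[ g ->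
  {in `]a, b[, forall x, 0 <= g x <= (f x)%:E}%E ->
  {in `]a, b[ &, forall x y, F y - F x <= M} ->
  (\int[mu]_(x in `]a, b[) g x <= M%:E)%E.
Proof.
move=> M0 dF cf mg gf FM.
pose I n := `[a + n.+1%:R^-1, b - n.+1%:R^-1]%classic : set R.
have Isub n : I n `<=` `]a, b[%classic.
  by rewrite itv_oo_bigcup; exact: bigcup_sup.
have mgI n : measurable_fun (I n) g by exact: measurable_funS mg.
have g0 n x : I n x -> (0 <= g x)%E by move=> /Isub /gf/andP[].
have cvgI : (\int[mu]_(x in I i) g x)%E @[i --> \oo] -->
    (\int[mu]_(x in `]a, b[) g x)%E.
  rewrite itv_oo_bigcup; apply: ge0_nondecreasing_set_cvg_integral => //.
  - move=> n m nm; apply/subsetPset => x; rewrite /I /= !in_itv/=.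
    have : m.+1%:R^-1 <= n.+1%:R^-1 :> R.
      by rewrite lef_pV2 ?posrE ?ltr0n// ler_nat.
    move: (m.+1%:R^-1) (n.+1%:R^-1) => e e' ee' /andP[? ?].
    by apply/andP; split; lra.
  - by move=> n; exact: measurable_itv.
rewrite -(cvg_lim _ cvgI)//; apply: lime_le.
  by apply/cvg_ex; eexists; exact: cvgI.
near=> n; set c := a + n.+1%:R^-1; set d := b - n.+1%:R^-1.
(* If [d <= c], the truncated interval has at most one point and its integral is 0 <= M. *)
have [cd|dc] := ltP c d; last first.
  rewrite (integral_Sset1 c) ?lee_fin// => x; rewrite /I /= in_itv/=.
  rewrite -/c -/d => /andP[cx xd].
  by apply/eqP; rewrite eq_le; apply/andP; split; lra.
have cfI : {within I n, continuous f}.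
  by apply: continuous_in_subspaceT => x; rewrite inE => /Isub; exact: cf.
have mI : measurable (I n) by exact: measurable_itv.
have mf : measurable_fun (I n) (EFin \o f).
  by apply/measurable_EFinP; exact: subspace_continuous_measurable_fun.
apply: (@le_trans _ _ (\int[mu]_(x in I n) (f x)%:E)%E).
  apply: ge0_le_integral; [exact: mI|exact: g0|exact: mgI|exact: mf|].
  by move=> x /Isub /gf/andP[].
have Fc x : I n x -> {for x, continuous F}.
  move=> /Isub /dF dFx; apply: differentiable_continuous.
  by apply/derivable1_diffP; exact: ex_derive.
have Ic : I n c by rewrite /I /= in_itv/= lexx ltW.
have Id : I n d by rewrite /I /= in_itv/= lexx ltW.
rewrite (@continuous_FTC2 _ f F c d cd)//.
- by rewrite -EFinB lee_fin; apply: FM; exact: (Isub n).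
- split.
  + move=> x xcd; have := dF x; case=> //; apply: (Isub n).
    by apply: subset_itv_oo_cc.
  + by apply: cvg_at_right_filter; exact: Fc.
  + by apply: cvg_at_left_filter; exact: Fc.
- move=> x xcd; rewrite derive1E; have := dF x; case=> //; apply: (Isub n).
  by apply: subset_itv_oo_cc.
Unshelve. all: by end_near. Qed.

(** With e = 1 to the left of [t] and e = -1 to the right, e(x - t) = -|x - t|, so this is an
    antiderivative of the kernel on either side of the singularity. *)
Lemma is_derive_sqrt_expR (e t x : R) : e * (x - t) < 0 ->
  let q x := expR (e * (x - t)) in
  is_derive x 1 (fun x => - (2 * e * Num.sqrt (1 - q x)))
    (e ^+ 2 * (q x / Num.sqrt (1 - q x))).
Proof.
move=> xt q.
have q1 : q x < 1 by rewrite -[ltRHS]expR0 ltr_expR.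
have s0 : 0 < Num.sqrt (1 - q x) by rewrite sqrtr_gt0 subr_gt0.
have dl : is_derive x 1 (fun x => e * (x - t)) e.
  by apply: is_derive_eq; rewrite /GRing.scale/= subr0 mulr1.
have dq : is_derive x 1 q (expR (e * (x - t)) * e) by exact: is_derive1_comp.
have d1 : is_derive x 1 (fun x => 1 - q x) (- (expR (e * (x - t)) * e)).
  by apply: is_derive_eq; rewrite add0r mul1r.
have ds : is_derive x 1 (fun x => Num.sqrt (1 - q x))
  ((2 * Num.sqrt (1 - q x))^-1 * - (expR (e * (x - t)) * e)).
  by apply: is_derive1_comp; apply: is_derive1_sqrt; rewrite subr_gt0.
apply: is_derive_eq.
by rewrite /GRing.scale/= -/(q x); field; rewrite gt_eqF.
Qed.

Lemma continuous_sqrt_expR (e t x : R) : e * (x - t) < 0 ->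
  {for x, continuous (fun x =>
    expR (e * (x - t)) / Num.sqrt (1 - expR (e * (x - t))))}.
Proof.
move=> xt.
have q1 : expR (e * (x - t)) < 1 by rewrite -[ltRHS]expR0 ltr_expR.
have cl : {for x, continuous (fun x => e * (x - t))}.
  by apply: cvgM; [exact: cvg_cst|apply: cvgB; [exact: cvg_id|exact: cvg_cst]].
have cq : {for x, continuous (fun x => expR (e * (x - t)))}.
  by apply: (@continuous_comp _ _ _ _ expR) => //; exact: continuous_expR.
apply: cvgM => //; apply: cvgV; first by rewrite gt_eqF// sqrtr_gt0 subr_gt0.
apply: (@continuous_comp _ _ _ (fun x => 1 - expR (e * (x - t))) Num.sqrt).
  by apply: cvgB => //; exact: cvg_cst.
exact: sqrt_continuous.
Qed.

(** On each side of [t] the antiderivative 3 * (-2e sqrt(1 - q)) varies by at most 6, since the root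
    stays in [0,1]; the two sides add up to 12. *)
Lemma integral_exp_kernel_le (a b t : R) (g : R -> \bar R) :
  a <= t <= b -> measurable_fun setT g -> (forall x, 0 <= g x)%E ->
  {in `[a, b], forall x, x != t ->
    let q := expR (- `|x - t|) in
    (g x <= (3 * (q / Num.sqrt (1 - q)))%:E)%E} ->
  (\int[mu]_(x in `[a, b]) g x <= 12%:E)%E.
Proof.
move=> /andP[a_le b_ge] mg g0 gle.
have side (e c d : R) : e ^+ 2 = 1 -> `]c, d[ `<=` `[a, b]%classic ->
    {in `]c, d[, forall x, `|x - t| = - (e * (x - t)) /\ e * (x - t) < 0} ->
    (\int[mu]_(x in `]c, d[) g x <= 6%:E)%E.
  move=> e1 cdab nE; set q := fun x => expR (e * (x - t)).
  apply: (@integral_le_antiderivative c d 6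
    (fun x => 3 * - (2 * e * Num.sqrt (1 - q x)))
    (fun x => 3 * (q x / Num.sqrt (1 - q x))) g).
  - by [].
  - move=> x /nE[_ xt]; have := @is_derive_sqrt_expR e t x xt.
    rewrite /= e1 mul1r => h.
    by apply: is_derive_eq; rewrite /GRing.scale/=.
  - move=> x /nE[_ xt]; apply: cvgM; first exact: cvg_cst.
    exact: continuous_sqrt_expR.
  - exact: measurable_funTS.
  - move=> x xcd; rewrite g0/=; have [nx xt] := nE _ xcd.
    have := gle x (cdab _ xcd); rewrite nx opprK; apply.
    by apply: contraTneq xt => ->; rewrite subrr mulr0 ltxx.
  - move=> x y /nE[_ xt] /nE[_ yt].
    have sb z : e * (z - t) < 0 -> 0 <= Num.sqrt (1 - q z) <= 1.
      move=> zt; rewrite sqrtr_ge0 -[leRHS]sqrtr1 ler_wsqrtr//.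
      by rewrite gerBl expR_ge0.
    have /andP[? ?] := sb _ xt; have /andP[? ?] := sb _ yt.
    have : e = 1 \/ e = -1.
      by move/eqP: e1; rewrite sqrf_eq1 => /orP[]/eqP; [left|right].
    by move=> [] ->; lra.
(* Split at [t], then pass to open intervals, which discards only null sets and removes the singular
   point. *)
rewrite (@itv_bndbnd_setU _ _ _ (BRight t))// ge0_integral_setU//=; last 2 first.
  exact: measurable_funTS.
  apply/disj_setPS => x [] /=; rewrite !in_itv/=; lra.
rewrite !integral_itv_bndoo; [|exact: measurable_funTS..].
rewrite (_ : 12%:E = 6%:E + 6%:E)%E; last by rewrite -EFinD; congr EFin; ring.
apply: leeD.
- apply: (side 1); first by rewrite expr1n.
    by move=> x; rewrite /= !in_itv/=; lra.
  by move=> x; rewrite in_itv/= => /andP[? ?]; rewrite mul1r ltr0_norm ?subr_lt0.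
- apply: (side (-1)); first by rewrite sqrrN expr1n.
    by move=> x; rewrite /= !in_itv/=; lra.
  move=> x; rewrite in_itv/= => /andP[? ?].
  by rewrite mulN1r opprK gtr0_norm ?subr_gt0// oppr_lt0 subr_gt0.
Qed.

End improper_integral.

(** * Borel sets of the plane *)

Section plane_borel.
Context {R : realType}.

(** An open set is the union of the rational boxes it contains. Other boxes are replaced by the
    empty set, so that the union runs over a fixed countable type. *)
Lemma open_measurable_prod (U : set (R * R)) : open U -> measurable U.
Proof.
move=> oU.
pose box (i : (rat * rat) * (rat * rat)) : set (R * R) :=
  `]ratr i.1.1, ratr i.1.2[%classic `*` `]ratr i.2.1, ratr i.2.2[%classic.
pose F i := if pselect (box i `<=` U) then box i else set0.
rewrite (_ : U = \bigcup_i F i); last first.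
  apply/seteqP; split=> [z Uz|z [i _]]; last first.
    by rewrite /F; case: pselect => //= h; exact: h.
  have /nbhs_ballP[e /= e0 zU] : nbhs z U by exact: open_nbhs_nbhs.
  have near_rat (x : R) : exists q1 q2 : rat,
      [/\ x - e < ratr q1, ratr q1 < x, x < ratr q2 & ratr q2 < x + e].
    have [q1] : exists q, ratr q \in `]x - e, x[.
      by apply: rat_in_itvoo; rewrite gtrBl.
    have [q2] : exists q, ratr q \in `]x, x + e[.
      by apply: rat_in_itvoo; rewrite ltrDl.
    by rewrite !in_itv/= => /andP[? ?] /andP[? ?]; exists q1, q2.
  have [a [b [ha1 ha2 hb1 hb2]]] := near_rat z.1.
  have [c [d [hc1 hc2 hd1 hd2]]] := near_rat z.2.
  exists ((a, b), (c, d)) => //; rewrite /F; case: pselect => [h|h] /=; last first.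
    exfalso; apply: h => w [] /=; rewrite !in_itv/= => /andP[? ?] /andP[? ?]; apply: zU.
    by split; rewrite /ball/= ltr_distl; apply/andP; split; lra.
  by split; rewrite /= in_itv/=; apply/andP.
apply: countable_bigcupT_measurable; first exact: countableP.
by move=> i; rewrite /F; case: pselect => //= h; exact: measurableX.
Qed.

Lemma compact_measurable_prod (K : set (R * R)) : compact K -> measurable K.
Proof.
move=> /(compact_closed (@norm_hausdorff _ (R * R)%type))/closed_openC.
by move=> /open_measurable_prod/measurableC; rewrite setCK.
Qed.

End plane_borel.

(** * Measurable sections of continuous maps on compact sets *)

Section measurable_section.
Context {R : realType}.

Lemma measurable_fun_sublevel (D : set R) (f : R -> R) : measurable D ->
  (forall x, measurable (D `&` [set t | f t <= x])) -> measurable_fun D f.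
Proof.
move=> mD mf; apply: (measurability _ (RGenOInfty.measurableE R)).
move=> /= _ [_ [x ->] <-].
rewrite (_ : _ `&` _ = D `\` (D `&` [set t | f t <= x])).
  exact: measurableD.
apply/seteqP; split=> t /=; rewrite in_itv/= andbT.
  by move=> [Dt xt]; split=> // -[_]; rewrite leNgt xt.
by move=> [Dt h]; split=> //; rewrite ltNge; apply/negP => ft; exact: h.
Qed.

Variable T : R * R -> R.

(** Meaningful for [t] in the image of [A] under [T]; elsewhere it is the infimum of the empty
    set. *)
Definition fibre_min (p : R * R -> R) (A : set (R * R)) (t : R) : R :=
  inf (p @` (A `&` T @^-1` [set t])).

Lemma compact_fibre (A : set (R * R)) t :
  compact A -> {within A, continuous T} -> compact (A `&` T @^-1` [set t]).
Proof.
move=> cA /continuous_closedP /(_ [set t]) cT.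
have /cT/closed_subspaceP[V cV VA] : closed [set t].
  by apply: accessible_closed_set1; exact/hausdorff_accessible/Rhausdorff.
by rewrite setIC -VA setIC; exact: compact_closedI.
Qed.

Lemma fibre_minP (p : R * R -> R) (A : set (R * R)) t : continuous p ->
  compact A -> {within A, continuous T} -> (T @` A) t ->
  (exists z, [/\ A z, T z = t & p z = fibre_min p A t]) /\
  (forall z, A z -> T z = t -> fibre_min p A t <= p z).
Proof.
move=> cp cA cT [z0 Az0 Tz0].
have [|||z] := @compact_EVT_min _ _ p (A `&` T @^-1` [set t]).
- by exists z0.
- exact: compact_fibre.
- exact: continuous_subspaceT.
rewrite inE => -[Az Tz] zmin.
have lb : lbound (p @` (A `&` T @^-1` [set t])) (p z).
  by move=> _ [w Aw <-]; apply: zmin; rewrite inE.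
have zE : p z = fibre_min p A t.
  apply/eqP; rewrite eq_le; apply/andP; split.
    by apply: lb_le_inf => //; exists (p z), z.
  by apply: ge_inf; [exists (p z)|exists z].
split; first by exists z.
by move=> w Aw Tw; rewrite -zE; apply: zmin; rewrite inE.
Qed.

Lemma measurable_image (A : set (R * R)) :
  compact A -> {within A, continuous T} -> measurable (T @` A).
Proof.
by move=> cA cT; apply: compact_measurable; exact: continuous_compact.
Qed.

Lemma compact_sublevel (p : R * R -> R) (A : set (R * R)) x :
  continuous p -> compact A -> compact (A `&` [set z | p z <= x]).
Proof.
move=> cp cA; apply: compact_closedI => //.
apply: (@preimage_closed _ _ p [set y | y <= x]); last exact: closed_le.
by move=> ? _; exact: cp.
Qed.

(** Because the minimum on a fibre is attained, its sublevel sets are the images under [T] of the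
    compact sublevel sets of [p] in [A], hence compact. *)
Lemma measurable_fibre_min (p : R * R -> R) (A : set (R * R)) : continuous p ->
  compact A -> {within A, continuous T} ->
  measurable_fun (T @` A) (fibre_min p A).
Proof.
move=> cp cA cT; apply: measurable_fun_sublevel; first exact: measurable_image.
move=> x; rewrite (_ : _ `&` _ = T @` (A `&` [set z | p z <= x])).
  apply: measurable_image; first exact: compact_sublevel.
  by apply: continuous_subspaceW cT; exact: subIsetl.
apply/seteqP; split=> t /=.
  move=> [At tx]; have [[z [Az Tz pz]] _] := fibre_minP _ _ _ cp cA cT At.
  by exists z => //; split=> //=; rewrite pz.
move=> [z [Az zx] Tz]; have At : (T @` A) t by exists z.
split=> //; have [_ /(_ z Az Tz)] := fibre_minP _ _ _ cp cA cT At.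
by move=> /le_trans; apply.
Qed.

(* The section picks the lexicographically least point of each fibre. *)
Lemma measurable_section (K : set (R * R)) : K !=set0 ->
  compact K -> {within K, continuous T} ->
  exists s : R -> R * R, [/\ measurable_fun setT s, (forall t, K (s t)) &
    forall t, (T @` K) t -> T (s t) = t].
Proof.
move=> [k0 Kk0] cK cT; set D := T @` K.
have cfst : continuous (@fst R R) by move=> z; exact: cvg_fst.
have csnd : continuous (@snd R R) by move=> z; exact: cvg_snd.
have mD : measurable D by exact: measurable_image.
pose s1 := fibre_min fst K.
pose Kt t := K `&` [set z | z.1 = s1 t].
have cKt t : compact (Kt t).
  apply: compact_closedI => //.
  apply: (@preimage_closed _ _ fst [set s1 t]); first by move=> ? _; exact: cfst.
  by apply: accessible_closed_set1; exact/hausdorff_accessible/Rhausdorff.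
have cTt t : {within Kt t, continuous T}.
  by apply: continuous_subspaceW cT; exact: subIsetl.
pose s2 t := fibre_min snd (Kt t) t.
have DKt t : D t -> (T @` Kt t) t.
  by move=> /(fibre_minP _ _ _ cfst cK cT)[[z [Kz Tz z1]] _]; exists z.
have s2P t (Dt : D t) := fibre_minP _ _ _ csnd (cKt t) (cTt t) (DKt t Dt).
have sP t : D t -> K (s1 t, s2 t) /\ T (s1 t, s2 t) = t.
  move=> /s2P[[[z1 z2] [[/= Kz <-] Tz]]] + _.
  by rewrite /s2 /= => <-.
have ms1 : measurable_fun D s1 by exact: measurable_fibre_min.
have ms2 : measurable_fun D s2.
  apply: measurable_fun_sublevel => // y.
  (* The set [Kt t] varies with [t], so the previous lemma does not apply to [s2]. Instead
     [s2 t <= y] holds exactly when the fibre over [t] meets [Ky] and has the same least first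
     coordinate there as in [K]: an equality set of two measurable functions. *)
  pose Ky := K `&` [set z | z.2 <= y].
  have cKy : compact Ky by exact: compact_sublevel.
  have cTy : {within Ky, continuous T}.
    by apply: continuous_subspaceW cT; exact: subIsetl.
  have DyD : T @` Ky `<=` D by apply: image_subset; exact: subIsetl.
  have mDy : measurable (T @` Ky) by exact: measurable_image.
  rewrite (_ : _ `&` _ = T @` Ky `&`
    (fun t => fibre_min fst Ky t == s1 t) @^-1` [set true]).
    apply: measurable_fun_eqr => //; first exact: measurable_fibre_min.
    exact: measurable_funS ms1.
  apply/seteqP; split=> t /=.
    move=> [Dt ty]; have [[z [[Kz z1] Tz z2]] _] := s2P _ Dt.
    have Kyz : Ky z by split=> //=; rewrite z2.
    have Dyt : (T @` Ky) t by exists z.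
    split=> //; rewrite eq_le; apply/andP; split.
      rewrite -z1; exact: (fibre_minP _ _ _ cfst cKy cTy Dyt).2.
    have [[w [[Kw _] Tw <-]] _] := fibre_minP _ _ _ cfst cKy cTy Dyt.
    exact: (fibre_minP _ _ _ cfst cK cT Dt).2.
  move=> [Dyt /eqP e]; have Dt := DyD _ Dyt; split=> //.
  have [[w [[Kw wy] Tw w1]] _] := fibre_minP _ _ _ cfst cKy cTy Dyt.
  apply: le_trans wy; apply: (s2P _ Dt).2 => //.
  by split=> //=; rewrite w1.
have mind : measurable_fun setT (fun t => t \in D).
  apply: (measurable_fun_bool true).
  rewrite setTI (_ : _ @^-1` _ = D)//.
  by apply/seteqP; split=> t; [exact: set_mem|exact: mem_set].
have patch_measurable (h : R -> R) c : measurable_fun D h ->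
    measurable_fun setT (fun t => if t \in D then h t else c).
  move=> mh; apply: measurable_fun_if => //.
  by apply: measurable_funS mh => // t [_]; exact: set_mem.
(* Off the image [D] the section takes the constant value [k0], which keeps all its values in
   [K]. *)
exists (fun t =>
  (if t \in D then s1 t else k0.1, if t \in D then s2 t else k0.2)).
split.
- by apply: measurable_fun_pair; exact: patch_measurable.
- move=> t; case: ifPn => [|_]; last by case: k0 Kk0.
  by move=> /set_mem/sP[].
- by move=> t Dt; rewrite mem_set//; have [] := sP _ Dt.
Qed.

End measurable_section.

(** * Green energy and the test measure *)

Section green_energy.
Context {R : realType}.
Local Notation C := (R * R)%type.

Definition green2 (u : C * C) : \bar R := green u.1 u.2.

Lemma measurable_green2 : measurable_fun setT green2.
Proof.
have m11 : measurable_fun setT (fun u : C * C => u.1.1).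
  exact: measurableT_comp measurable_fst measurable_fst.
have m12 : measurable_fun setT (fun u : C * C => u.1.2).
  exact: measurableT_comp measurable_snd measurable_fst.
have m21 : measurable_fun setT (fun u : C * C => u.2.1).
  exact: measurableT_comp measurable_fst measurable_snd.
have m22 : measurable_fun setT (fun u : C * C => u.2.2).
  exact: measurableT_comp measurable_snd measurable_snd.
have mA : measurable_fun setT (fun u : C * C => cdist2 u.1 u.2).
  by apply: measurable_funD; apply: measurable_funX; apply: measurable_funB.
have mB : measurable_fun setT (fun u : C * C => ccross2 u.1 u.2).
  apply: measurable_funD; apply: measurable_funX => /=.
    apply: measurable_funB => //.
    by apply: measurable_funD; apply: measurable_funM.
  apply: measurableT_comp => //.
  by apply: measurable_funB; apply: measurable_funM.
have mls (f : C * C -> R) : measurable_fun setT f ->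
    measurable_fun setT (fun u : C * C => ln (Num.sqrt (f u)) : R).
  have msqrt : measurable_fun setT (@Num.sqrt R).
    by apply: continuous_measurable_fun; exact: sqrt_continuous.
  move=> mf; apply: (measurableT_comp (@measurable_ln R)).
  exact: (measurableT_comp msqrt mf).
(* The formula must hold on the whole plane: where [ccross2] vanishes, division by zero makes [rho]
   equal to 0, and [ln] at 0 is 0. *)
rewrite (_ : green2 = fun u => if cdist2 u.1 u.2 == 0 then +oo%E else
  (if ccross2 u.1 u.2 == 0 then 0
   else ln (Num.sqrt (ccross2 u.1 u.2)) - ln (Num.sqrt (cdist2 u.1 u.2)))%:E).
  apply: measurable_fun_ifT => //; first exact: measurable_fun_eqr.
  apply/measurable_EFinP; apply: measurable_fun_ifT => //.
    exact: measurable_fun_eqr.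
  by apply: measurable_funB; exact: mls.
apply/funext => u; rewrite /green2 /green -cdist2_eq0; case: ifPn => // A0.
congr EFin; rewrite rhoE; case: ifPn => [/eqP ->|B0].
  by rewrite sqrtr0 invr0 mulr0 ln0// oppr0.
rewrite ln_div ?posrE ?sqrtr_gt0 ?lt_neqAle ?csqnorm_ge0 ?andbT 1?eq_sym//.
by rewrite opprB.
Qed.

Lemma green_ge0 (z w : C) : disc z -> disc w -> (0 <= green z w)%E.
Proof.
move=> dz dw; rewrite /green; case: ifPn => // _.
by rewrite lee_fin oppr_ge0 ln_le0// ltW// rho_lt1.
Qed.

Lemma green2_posE (z w : C) : disc z -> disc w -> (green2^\+ (z, w) = green z w)%E.
Proof. by move=> dz dw; rewrite funeposE; apply/max_idPl/green_ge0. Qed.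

Lemma measurable_potential (mu : probability C R) (f : C * C -> \bar R) :
  measurable_fun setT f -> (forall u, 0 <= f u)%E ->
  measurable_fun setT (fun z => \int[mu]_w f (z, w))%E.
Proof. by move=> mf f0; exact: measurable_fun_fubini_tonelli_F. Qed.

(** The Green function can be negative off the disc, whereas its positive part is nonnegative
    everywhere and so open to Tonelli arguments. The two agree on K x K, which carries the product
    measure. *)
Lemma energyE (K : set C) (mu : probability C R) : measurable K ->
  K `<=` @disc R -> mu (~` K) = 0%E ->
  energy mu = (\int[mu]_z \int[mu]_w green2^\+ (z, w))%E.
Proof.
move=> mK Kd muK.
have ae_eqK (f g : C -> \bar R) : (forall z, K z -> f z = g z) ->
    ae_eq mu setT f g.
  move=> fg; exists (~` K); split => //; first exact: measurableC.
  by move=> z /= h Kz; apply: h => _; exact: fg.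
have mgreen (z : C) : measurable_fun setT (green z).
  exact: (measurable_fun_pair2 z measurable_green2).
have mp : measurable_fun setT (green2^\+%E : C * C -> \bar R).
  by apply: measurable_funepos; exact: measurable_green2.
have mn : measurable_fun setT (green2^\-%E : C * C -> \bar R).
  by apply: measurable_funeneg; exact: measurable_green2.
apply: ae_eq_integral => //.
(* Measurability of the potential itself: it is the difference of the potentials of the positive and
   negative parts. *)
- rewrite (_ : (fun _ => _) = (fun z => \int[mu]_w green2^\+ (z, w) -
      \int[mu]_w green2^\- (z, w))%E).
    by apply: emeasurable_funB; apply: measurable_potential => // u;
      rewrite ?funepos_ge0 ?funeneg_ge0.
  apply/funext => z; rewrite integralE; congr (_ - _)%E;
    by apply: eq_integral => w _; rewrite !(funeposE, funenegE).
- by apply: measurable_potential => // u; exact: funepos_ge0.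
- apply: (ae_eqK _ _) => z Kz; apply: ae_eq_integral => //.
    exact: (measurable_fun_pair2 z mp).
  by apply: ae_eqK => w Kw; rewrite green2_posE//; exact: Kd.
Qed.

Lemma green_V_ge0 (K : set C) : measurable K -> K `<=` @disc R ->
  (0 <= green_V K)%E.
Proof.
move=> mK Kd; apply: le_ereal_inf_tmp => _ [mu /= muK <-].
rewrite (energyE _ _ mK Kd muK); apply: integral_ge0 => z _.
by apply: integral_ge0 => w _; exact: funepos_ge0.
Qed.

Lemma continuous_hypdist (a z : C) : disc a -> disc z ->
  {for z, continuous (hypdist a)}.
Proof.
move=> da dz.
have c1 : {for z, continuous (@fst R R)} by exact: cvg_fst.
have c2 : {for z, continuous (@snd R R)} by exact: cvg_snd.
have ck (k : R) : {for z, continuous (fun _ : C => k)} by exact: cvg_cst.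
have csq (f g : C -> R) : {for z, continuous f} -> {for z, continuous g} ->
    {for z, continuous (fun w => csqnorm (f w, g w))}.
  by move=> cf cg; apply: cvgD; rewrite /=; apply: cvgM.
have cs (f : C -> R) : {for z, continuous f} ->
    {for z, continuous (fun w => Num.sqrt (f w))}.
  move=> cf; apply: (@continuous_comp _ _ _ f Num.sqrt) => //.
  exact: sqrt_continuous.
have crho : {for z, continuous (rho a)}.
  apply: cvgM.
    by apply/cs/csq; apply: cvgB => //; exact: ck.
  apply: cvgV; first by rewrite gt_eqF// sqrtr_gt0 ccross2_gt0.
  apply/cs/csq.
    by apply: cvgB; [exact: ck|apply: cvgD; apply: cvgM => //; exact: ck].
  by apply: cvgN; apply: cvgB; apply: cvgM => //; exact: ck.
apply: (@continuous_comp _ _ _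
  (fun w => (1 + rho a w) / (1 - rho a w)) (@ln R)).
  apply: cvgM; first by apply: cvgD => //; exact: ck.
  apply: cvgV; first by rewrite gt_eqF// subr_gt0 rho_lt1.
  by apply: cvgB => //; exact: ck.
apply: continuous_ln; rewrite divr_gt0 ?subr_gt0 ?rho_lt1//.
by rewrite ltr_wpDr ?rho_ge0.
Qed.

(** The test measure is the law of [s] under the uniform distribution on [0,L]. Its energy is an
    average of potentials, each at most 12/L. *)
Lemma green_V_le (K : set C) (a b : C) : compact K -> connected K ->
  K `<=` @disc R -> K a -> K b -> 0 < hypdist a b ->
  (green_V K <= (12 / hypdist a b)%:E)%E.
Proof.
move=> cK conK Kd Ka Kb L0; set L := hypdist a b in L0 *.
have da := Kd _ Ka.
have cT : {within K, continuous (hypdist a)}.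
  apply: continuous_in_subspaceT => z; rewrite inE => /Kd dz.
  exact: continuous_hypdist.
have mK := compact_measurable_prod _ cK.
(* The image of [K] is an interval containing 0, the value at [a], and L, the value at [b]. *)
have TK t : t \in `[0, L] -> (hypdist a @` K) t.
  rewrite in_itv/= => tL.
  have /connected_intervalP := connected_continuous_connected conK cT.
  apply; [| |exact: tL].
    by exists a => //; rewrite /hypdist rhozz addr0 subr0 divr1 ln1.
  by exists b.
have K0 : K !=set0 by exists a.
have [s [ms Ks sT]] := measurable_section _ _ K0 cK cT.
have ms' : measurable_fun [set: measurableTypeR R] s by exact: ms.
pose X : {mfun measurableTypeR R >-> C} :=
  HB.pack s (isMeasurableFun.Build _ _ (measurableTypeR R) C s ms').
pose P : probability (measurableTypeR R) R := uniform_prob L0.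
pose mu : probability C R := distribution P X.
have muK : mu (~` K) = 0%E.
  rewrite /mu /= /distribution /pushforward (_ : _ @^-1` _ = set0) ?measure0//.
  by apply/seteqP; split=> t //=; apply.
have mp : measurable_fun setT (green2^\+%E : C * C -> \bar R).
  by apply: measurable_funepos; exact: measurable_green2.
have p0 (u : C * C) : (0 <= green2^\+ u)%E by exact: funepos_ge0.
have mpot := measurable_potential mu _ mp p0.
have pot0 z : (0 <= \int[mu]_w green2^\+ (z, w))%E by exact: integral_ge0.
have intmu (f : C -> \bar R) :
    measurable_fun setT f -> (forall z, 0 <= f z)%E ->
    (\int[mu]_z f z =
     (L^-1)%:E * \int[lebesgue_measure]_(t in `[0%R, L]) f (s t))%E.
  move=> mf f0; rewrite /mu /= /distribution ge0_integral_pushforward//.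
  rewrite preimage_setT /P/= integral_uniform ?subr0//.
  exact: measurableT_comp.
have pot_le t : t \in `[0, L] ->
    (\int[mu]_w green2^\+ (s t, w) <= (12 / L)%:E)%E.
  move=> tL; have tE := sT t (TK _ tL).
  rewrite intmu//; last exact: (measurable_fun_pair2 (s t) mp).
  rewrite mulrC EFinM lee_pmul2l ?lte_fin ?invr_gt0//.
  apply: (@integral_exp_kernel_le _ _ _ t); first by rewrite in_itv/= in tL.
  - exact: (measurableT_comp (measurable_fun_pair2 (s t) mp) ms).
  - by [].
  (* As [s] is a section, the hyperbolic distances from [a] to [s t] and [s x] are [t] and [x], so
     the kernel depends on |x - t| only. *)
  - move=> x xL xt; have xE := sT x (TK _ xL).
    rewrite green2_posE; [|exact/Kd|exact/Kd].
    have := green_le_hypdist a (s t) (s x) da (Kd _ (Ks t)) (Kd _ (Ks x)).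
    by rewrite tE xE eq_sym distrC; exact.
apply: ge_ereal_inf; exists (energy mu); first by exists mu.
rewrite (energyE _ _ mK Kd muK) intmu//.
apply: (@le_trans _ _ ((L^-1)%:E *
  \int[lebesgue_measure]_(t in `[0%R, L]) (12 / L)%:E)%E).
  rewrite lee_pmul2l ?lte_fin ?invr_gt0//.
  apply: ge0_le_integral => //.
  exact: (measurable_funTS (measurableT_comp mpot ms)).
rewrite integral_cst//= lebesgue_measure_itv/= lte_fin L0 oppr0 adde0.
by rewrite -!EFinM lee_fin mulrC mulfK ?gt_eqF.
Qed.

End green_energy.

Theorem theorem3p12 (R : realType) :
  exists c : R, 0 < c /\
    forall (K : set (R * R)%type), compact K -> connected K -> K `<=` @disc R ->
    forall eps : R, 0 < eps -> eps < 1 ->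
      diam_rho K > 1 - eps ->
      ((c * ln (eps^-1))%:E <= green_cap K)%E.
Proof.
exists (12^-1); split; first by rewrite invr_gt0.
move=> K cK conK Kd eps eps0 eps1 diamK.
(* An empty [K] is excluded since the supremum of the empty set is 0, below 1 - eps. *)
have [_ [a Ka [b Kb <-]] rab] : exists2 r,
    [set rho z w | z in K & w in K] r & 1 - eps < r.
  apply: sup_gt => //; apply/set0P; apply: contraTneq diamK => S0.
  by rewrite /diam_rho S0 sup0 -leNgt subr_ge0 ltW.
have da := Kd _ Ka; have db := Kd _ Kb.
have r1 := rho_lt1 _ _ da db; have r0 := rho_ge0 a b.
(* With r = rho(a,b), (1 + r)/(1 - r) >= 1/(1 - r) > 1/eps. *)
have lnL : ln eps^-1 <= hypdist a b.
  rewrite /hypdist ler_ln ?posrE ?invr_gt0// ?divr_gt0 ?subr_gt0 ?ltr_wpDr//.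
  rewrite ler_pdivlMr ?subr_gt0// mulrC ler_pdivrMr//; nra.
have ln0 : 0 < ln eps^-1 by rewrite ln_gt0// invf_gt1.
have L0 := lt_le_trans ln0 lnL.
have Vle := green_V_le _ _ _ cK conK Kd Ka Kb L0.
have := green_V_ge0 _ (compact_measurable_prod _ cK) Kd.
(* The two bounds on [green_V K] exclude both infinite values; when it is 0 the capacity is +oo by
   convention. *)
rewrite /green_cap; case: (green_V K) Vle => [v| |]//.
rewrite !lee_fin => vL v0; case: ifPn => [_|v_neq0]; first exact: leey.
have {v_neq0}v0 : 0 < v by rewrite lt_neqAle eq_sym v_neq0.
rewrite lee_fin; apply: (@le_trans _ _ (12^-1 * hypdist a b)).
  by rewrite ler_pM2l// invr_gt0.
by rewrite -[leLHS]invrK invfM invrK lef_pV2 ?posrE// divr_gt0.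
Qed.
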